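(* Assume that for each $j=1:m$ there exists $B_j>0$ such that $\|\nabla h_j(x)\|\le B_j$ for all $\nabla h_j(x)\in\partial h_j(x)$ and all $x\in\mathcal{Y}$. Let the random vector $\xi\in\mathbb{R}^m$ satisfy $\xi\ge 0$, $\mathbb{E}[\xi^j]>0$ and $\xi^j\le\bar\xi$ for all $j=1:m$ and some $\bar\xi<\infty$. Then the functions $h(\cdot,\xi)=\max_{j=1:m}(\xi^j h_j(\cdot))$ have bounded subgradients on $\mathcal{Y}$: $$\|\nabla h(x,\xi)\|\le\mathcal{B}_h\qquad\text{for all } x\in\mathcal{Y},\ \text{all realizations of } \xi,\ \text{and all } \nabla h(x,\xi)\in\partial h(x,\xi),$$ where $\mathcal{B}_h=\bar\xi\,\max_{j=1:m}B_j$.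
   Context: $\mathcal{Y}\subseteq\mathbb{R}^n$ is a nonempty closed convex set; $h_j$, $j=1:m$ (i.e. $j\in\{1,\dots,m\}$), are proper lower semicontinuous convex functions on $\mathbb{R}^n$ whose effective domains contain the interior of $\mathcal{Y}$. The random vector $\xi$ has components $\xi^1,\dots,\xi^m$ and is drawn from a probability distribution on a finite probability space. $\partial h(x,\xi)$ denotes the convex subdifferential of $h(\cdot,\xi)$ at $x$ (with respect to $x$). $\|\cdot\|$ is the Euclidean norm.
   Formalization: If Y has empty interior, Y is additionally assumed to lie in the interior of the effective domain of every h_j; without this the claim fails (Y={0}, h_1(x)=-√x for x≥0 and +∞ otherwise, h_2(x)=h_1(-x), ξ=(1,1)). *)

(* Defs.v *)
From mathcomp Require Export all_boot all_order all_algebra.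
From mathcomp Require Export all_classical all_reals all_analysis.
Import Order.TTheory GRing.Theory Num.Theory.
Import numFieldNormedType.Exports.

Set Implicit Arguments.
Unset Strict Implicit.
Unset Printing Implicit Defensive.

Local Open Scope classical_set_scope.
Local Open Scope ring_scope.

Definition dotv (R : realType) (n : nat) (u v : 'rV[R]_n) : R :=
  \sum_(i < n) u ord0 i * v ord0 i.

(* The library norm on 'rV[R]_n is the sup norm, hence this definition. The
   topology, and so closedness, interior and semicontinuity, is the same. *)
Definition enorm (R : realType) (n : nat) (u : 'rV[R]_n) : R :=
  Num.sqrt (dotv u u).

Definition edom (R : realType) (n : nat) (f : 'rV[R]_n -> \bar R) :
  set 'rV[R]_n := [set x | (f x < +oo)%E].

Definition proper_fun (R : realType) (n : nat) (f : 'rV[R]_n -> \bar R) : Prop :=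
  edom f !=set0 /\ forall x, (-oo < f x)%E.

(* The library's convex_function is for real-valued functions only. Since
   -oo + +oo = -oo in \bar R, this notion is only meant for functions that
   never take the value -oo. *)
Definition econvex (R : realType) (n : nat) (f : 'rV[R]_n -> \bar R) : Prop :=
  forall (x y : 'rV[R]_n) (t : R), 0 < t < 1 ->
    (f (t *: x + (1 - t) *: y)%R <= t%:E * f x + (1 - t)%:E * f y)%E.

Definition subdiff (R : realType) (n : nat) (f : 'rV[R]_n -> \bar R)
    (x : 'rV[R]_n) : set 'rV[R]_n :=
  [set g | f x \is a fin_num /\
           forall y, (f x + (dotv g (y - x)%R)%:E <= f y)%E].

(* x |-> max_j a_j h_j(x). In \bar R, 0 * +oo = 0, so an index j with a_j = 0
   contributes the zero function, also outside the effective domain of h_j. *)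
Definition max_scaled (R : realType) (n m : nat) (a : 'I_m -> R)
    (h : 'I_m -> 'rV[R]_n -> \bar R) (x : 'rV[R]_n) : \bar R :=
  \big[maxe/-oo%E]_(j < m) ((a j)%:E * h j x)%E.

(* Main.v *)
Require Import Defs.
From mathcomp Require Import ring lra.
Import Order.TTheory GRing.Theory Num.Theory.
Import numFieldNormedType.Exports.
Local Open Scope classical_set_scope.
Local Open Scope ring_scope.

(** The idea is to bound the one-sided growth of each [h j] at [x] in every
direction [u] by [B j * enorm u].  Once this is known, scaling by [xi j w] and
taking the maximum over [j] bounds the growth of the maximum function in the
direction [g] by [xibar * Bmax * enorm g], where [Bmax] is the largest [B j].
A subgradient [g] at [x] forces growth at least [dotv g g = enorm g ^+ 2] in its
own direction, and dividing by [enorm g] gives the claim.  So neither the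
subdifferential of a maximum nor the set of active indices ever appears.

The directional growth bound ([directional_bound]) is a form of the max formula:
the directional derivative is the support function of the subdifferential.  If
[x] is on the boundary of the domain of [f], this is true in general only of the
closure of the directional derivative.  The proof therefore works with
[r + D * `|u - w|], minimized over the epigraph of the difference quotients:
this is a finite sublinear function of [u].  A finite-dimensional Hahn-Banach
argument ([sublinear_support]) gives a linear functional below it that touches
it at a chosen point; the functional is a subgradient of [f], hence bounded by
[B] ([subgradient_direction]).  Letting [D] tend to infinity shows that
directions arbitrarily close to [u] have growth about [B * enorm u] at most, and
the remaining gap is closed by moving slightly towards a ball on which [f] is
bounded above.

The argument needs [f x] to be finite and [f] to be above a downward cone with
apex [(x, f x)].  If [f] is finite near [x], this follows from local boundedness
([convex_locally_bounded], [minorized_of_bounded]).  If [Y] has an interior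
point [y0], then [f] has subgradients at the interior points of [Y] on the
segment from [x] to [y0], they are bounded by [B], so each of these points is the
apex of a cone of a fixed slope below [f]; lower semicontinuity carries the cones
to [x] ([minorized_of_subgradient_bound]).  This covers the
boundary points of [Y], where [f] is not assumed to be finite. *)

(** * Euclidean norm *)

Section Euclid.
Context {R : realType} {n : nat}.
Implicit Types u v w : 'rV[R]_n.

Lemma dotvC u v : dotv u v = dotv v u.
Proof. by apply: eq_bigr => i _; rewrite mulrC. Qed.

Lemma dotvDr u v w : dotv u (v + w) = dotv u v + dotv u w.
Proof. by rewrite /dotv -big_split; apply: eq_bigr => i _; rewrite mxE mulrDr. Qed.

Lemma dotvZr a u v : dotv u (a *: v) = a * dotv u v.
Proof. by rewrite /dotv mulr_sumr; apply: eq_bigr => i _; rewrite mxE mulrCA. Qed.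

Lemma dotvv_ge0 u : 0 <= dotv u u.
Proof. by apply: sumr_ge0 => i _; rewrite -expr2 sqr_ge0. Qed.

Lemma enorm_ge0 u : 0 <= enorm u.
Proof. exact: sqrtr_ge0. Qed.

Lemma sqr_enorm u : enorm u ^+ 2 = dotv u u.
Proof. by rewrite sqr_sqrtr// dotvv_ge0. Qed.

Lemma le_enorm u (a : R) : 0 <= a -> dotv u u <= a ^+ 2 -> enorm u <= a.
Proof. by move=> a0 ua; rewrite -(@ler_pXn2r _ 2) ?nnegrE ?enorm_ge0// sqr_enorm. Qed.

Lemma dotv_eq0 u v : dotv u u = 0 -> dotv u v = 0.
Proof.
move=> /eqP; rewrite psumr_eq0 => [/allP u0|i _]; last by rewrite -expr2 sqr_ge0.
rewrite /dotv big1// => i _.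
by have /= := u0 i (mem_index_enum _); rewrite mulf_eq0 orbb => /eqP ->; rewrite mul0r.
Qed.

Lemma dotv_le u v : dotv u v <= enorm u * enorm v.
Proof.
have [u0|u0] := eqVneq (dotv u u) 0.
  by rewrite dotv_eq0// mulr_ge0// enorm_ge0.
have ugt0 : 0 < dotv u u by rewrite lt_neqAle eq_sym u0 dotvv_ge0.
have sq : dotv u v ^+ 2 <= (enorm u * enorm v) ^+ 2.
  rewrite exprMn !sqr_enorm.
  (* The squared norm of the component of v orthogonal to u, scaled by u.u. *)
  have := dotvv_ge0 (dotv u u *: v + (- dotv u v) *: u).
  rewrite dotvDr !dotvZr ![dotv (_ + _) _]dotvC !dotvDr !dotvZr (dotvC v u) => h.
  have : 0 <= dotv u u * (dotv u u * dotv v v - dotv u v ^+ 2) by nra.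
  by rewrite pmulr_rge0// subr_ge0.
have := sq; rewrite -ler_sqrt ?sqr_ge0// !sqrtr_sqr.
by rewrite (ger0_norm (mulr_ge0 _ _)) ?enorm_ge0//; exact: le_trans (ler_norm _).
Qed.

Lemma enormD u v : enorm (u + v) <= enorm u + enorm v.
Proof.
apply: le_enorm; first by rewrite addr_ge0// enorm_ge0.
rewrite dotvDr ![dotv (_ + _) _]dotvC !dotvDr (dotvC v u).
have := dotv_le u v; rewrite -!sqr_enorm; nra.
Qed.

Lemma enormZ a u : enorm (a *: u) = `|a| * enorm u.
Proof.
by rewrite /enorm dotvZr dotvC dotvZr mulrA -expr2 sqrtrM ?sqr_ge0// sqrtr_sqr.
Qed.

Lemma le_coord_enorm u i : `|u ord0 i| <= enorm u.
Proof.
rewrite -(@ler_pXn2r _ 2) ?nnegrE ?enorm_ge0// sqr_enorm /dotv (bigD1 i)//=.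
rewrite real_normK ?num_real// -expr2 lerDl.
by apply: sumr_ge0 => j _; rewrite -expr2 sqr_ge0.
Qed.

Lemma le_coord_norm u i : `|u ord0 i| <= `|u|.
Proof.
have -> : `|u| = mx_norm u by []; rewrite mx_normrE.
exact: (le_bigmax 0 (fun ij => `|u ij.1 ij.2|) (ord0, i)).
Qed.

(** The notation [`|v|] is the sup norm, which is used for every estimate where the
constant does not matter; here the pairing is bounded in terms of it. *)
Lemma dotv_ge u v : - (n%:R * enorm u * `|v|) <= dotv u v.
Proof.
rewrite -mulrA -[X in X%:R]card_ord.
suff : `|dotv u v| <= #|'I_n|%:R * (enorm u * `|v|).
  by rewrite ler_norml => /andP[].
rewrite mulr_natl -sumr_const; apply: le_trans (ler_norm_sum _ _ _) _ => /=.
apply: ler_sum => i _; rewrite normrM.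
by apply: ler_pM => //; [exact: le_coord_enorm|exact: le_coord_norm].
Qed.

End Euclid.

(** * Sublinear functions and Hahn-Banach *)

(** Only one inequality is asked for homogeneity: the other one follows by
scaling back with [l^-1]. *)
Definition sublinear {R : realType} {V : lmodType R} (p : V -> R) : Prop :=
  (forall l u, 0 < l -> p (l *: u) <= l * p u) /\
  (forall u v, p (u + v) <= p u + p v).

Section Sublinear.
Context {R : realType} {V : lmodType R}.
Implicit Types (p q : V -> R) (u v : V).

Lemma sublinear_pZ p l u : sublinear p -> 0 < l -> p (l *: u) = l * p u.
Proof.
move=> [pZ _] l0; apply/eqP; rewrite eq_le pZ//=.
have l'0 : 0 < l^-1 by rewrite invr_gt0.
have := pZ _ (l *: u) l'0; rewrite scalerA mulVf ?gt_eqF// scale1r.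
by rewrite -(ler_pM2l l0) mulrA mulfV ?gt_eqF// mul1r.
Qed.

Lemma sublinear0 p : sublinear p -> p 0 = 0.
Proof.
move=> sp; have := sublinear_pZ p 2 0 sp (ltr0Sn _ _); rewrite scaler0; lra.
Qed.

Lemma sublinear_sum p (I : finType) (F : I -> V) :
  sublinear p -> p (\sum_i F i) <= \sum_i p (F i).
Proof.
move=> sp; elim/big_ind2: _ => [|a b c e ab ce|//]; first by rewrite sublinear0.
by apply: le_trans (sp.2 _ _) _; exact: lerD.
Qed.

(** A convex cone in [V * R] that is bounded below over each [u] has a lower
boundary, and this is the graph of a sublinear function.  Both sublinear functions
needed later are obtained in this way. *)
Lemma lower_envelope_sublinear (S : V -> R -> Prop) :
  (forall u r v s, S u r -> S v s -> S (u + v) (r + s)) ->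
  (forall l u r, 0 < l -> S u r -> S (l *: u) (l * r)) ->
  (forall u, exists r, S u r) ->
  (forall u, exists a, forall r, S u r -> a <= r) ->
  exists p, [/\ sublinear p, forall u r, S u r -> p u <= r &
                forall u a, (forall r, S u r -> a <= r) -> a <= p u].
Proof.
move=> SD SZ Sne Slb; pose p u := inf [set r | S u r].
have pS u r : S u r -> p u <= r.
  move=> ur; apply: ge_inf => //; have [a ha] := Slb u; exists a => s /=; exact: ha.
have pge u a : (forall r, S u r -> a <= r) -> a <= p u.
  by move=> ha; apply: lb_le_inf => [|r /=]; [exact: Sne|exact: ha].
exists p; split => //; split => [l u l0|u v].
  rewrite -ler_pdivrMl//; apply: pge => r ur; rewrite ler_pdivrMl//.
  by apply: pS; exact: SZ.
rewrite -lerBlDr; apply: (pge) => r ur; rewrite lerBlDr -lerBlDl.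
by apply: pge => s vs; rewrite lerBlDl; apply: pS; exact: SD.
Qed.

(** The inequality at [- e] says that [q] is linear on the line of [e], with slope
[p e]: subtracting the slope while moving forward along [e] can only lower [p]. *)
Lemma sublinear_linearize p e : sublinear p ->
  exists q, [/\ sublinear q, forall u, q u <= p u & q (- e) <= - p e].
Proof.
move=> sp; have [pZ pD] := sp.
have pt t : 0 <= t -> p (t *: e) = t * p e.
  rewrite le_eqVlt => /predU1P[<-|t0]; first by rewrite scale0r mul0r sublinear0.
  exact: sublinear_pZ.
have [] := lower_envelope_sublinear
  (fun v r => exists2 t, 0 <= t & p (v + t *: e) - t * p e <= r).
- move=> u r v r' [s s0 hs] [t t0 ht]; exists (s + t); first exact: addr_ge0.
  have -> : u + v + (s + t) *: e = (u + s *: e) + (v + t *: e).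
    by rewrite scalerDl addrACA.
  have := pD (u + s *: e) (v + t *: e); lra.
- move=> l u r l0 [t t0 ht]; exists (l * t); first by rewrite mulr_ge0// ltW.
  rewrite -scalerA -scalerDr sublinear_pZ// -mulrA -mulrBr.
  by rewrite ler_pM2l.
- by move=> u; exists (p u), 0; rewrite // scale0r addr0 mul0r subr0.
- move=> u; exists (- p (- u)) => r [t t0]; apply: le_trans.
  have := pD (u + t *: e) (- u); rewrite addrAC subrr add0r pt//; lra.
move=> q [sq qS _]; exists q; split=> // [u|].
  by apply: qS; exists 0; rewrite // scale0r addr0 mul0r subr0.
apply: qS; exists 1 => //.
by rewrite scale1r addNr sublinear0// mul1r sub0r.
Qed.

(** Linearity along a vector, written [q (- e) <= - q e], is inherited by every
smaller sublinear function, so the vectors can be treated one after the other. *)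
Lemma sublinear_linearize_seq p (s : seq V) : sublinear p ->
  exists q, [/\ sublinear q, forall u, q u <= p u &
                forall e, e \in s -> q (- e) <= - q e].
Proof.
move=> sp; elim: s => [|e s [q [sq qp qs]]]; first by exists p.
have [q' [sq' q'q q'e]] := sublinear_linearize q e sq.
exists q'; split=> // [u|f]; first exact: le_trans (q'q u) (qp u).
rewrite inE => /predU1P[->|fs].
  by apply: le_trans q'e _; rewrite lerN2.
by apply: le_trans (q'q _) _; apply: le_trans (qs _ fs) _; rewrite lerN2.
Qed.

End Sublinear.

(** Hahn-Banach in finite dimension: linearize first along [u0], which fixes the
value at [u0], then along the canonical basis, which makes the function linear. *)
Lemma sublinear_support {R : realType} {n : nat} (p : 'rV[R]_n -> R) u0 :
  sublinear p -> exists s, (forall v, dotv s v <= p v) /\ p u0 <= dotv s u0.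
Proof.
move=> sp; have [q0 [sq0 q0p q0u]] := sublinear_linearize p u0 sp.
have [q [sq qq0 qe]] :=
  sublinear_linearize_seq q0 [seq delta_mx ord0 i | i <- enum 'I_n] sq0.
pose s := \row_i q (delta_mx ord0 i).
have qle v : q v <= dotv s v.
  rewrite {1}(matrix_sum_delta v) big_ord1.
  apply: le_trans (sublinear_sum _ _ _ sq) _; apply: ler_sum => i _.
  have [vi|vi|->] := ltgtP (v ord0 i) 0; rewrite !mxE.
  - have -> : v ord0 i *: delta_mx ord0 i =
        (- v ord0 i) *: - delta_mx ord0 i :> 'rV[R]_n.
      by apply/rowP => k; rewrite !mxE mulrNN.
    rewrite sublinear_pZ ?oppr_gt0// mulNr -mulrN mulrC ler_nM2r//.
    by rewrite lerNr; apply: qe; apply: map_f; rewrite mem_enum.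
  - by rewrite sublinear_pZ// mulrC.
  - by rewrite scale0r sublinear0// mulr0.
have les v : dotv s v <= q v.
  have := qle (- v); rewrite -scaleN1r dotvZr mulN1r scaleN1r => qN.
  have := sq.2 v (- v); rewrite subrr sublinear0//; lra.
exists s; split=> [v|]; first by rewrite (le_trans (les v))// (le_trans (qq0 v)).
apply: le_trans (qle _).
have := sq.2 u0 (- u0); rewrite subrr sublinear0//.
have := qq0 (- u0); lra.
Qed.

(** * Convex functions and their difference quotients *)

(** The epigraph of the directional derivative of [f] at [x], up to closure, when
[f x = c%:E]: the cone generated by the epigraph of [f] seen from its point
[(x, c)]. *)
Definition epicone {R : realType} {n : nat} (f : 'rV[R]_n -> \bar R) x c
    (w : 'rV[R]_n) (r : R) : Prop :=
  exists2 t, 0 < t & (f (x + t *: w)%R <= (c + t * r)%:E)%E.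

(** [f] lies above the downward cone of slope [C] with apex [(x, c)]; the bound is
stated on real majorants of [f y], so that infinite values need no case. *)
Definition minorized {R : realType} {n : nat} (f : 'rV[R]_n -> \bar R) x c C
    : Prop :=
  forall y a, (f y <= a%:E)%E -> c - C * `|y - x| <= a.

Section ConvexFunction.
Context {R : realType} {n : nat} (f : 'rV[R]_n -> \bar R).
Hypothesis f_convex : econvex f.
Implicit Types (x y z u v w : 'rV[R]_n) (a b c r t C D M : R).

Lemma econvex_epi y z a b t : 0 < t < 1 ->
  (f y <= a%:E)%E -> (f z <= b%:E)%E ->
  (f (t *: y + (1 - t) *: z)%R <= (t * a + (1 - t) * b)%:E)%E.
Proof.
move=> t01 ya zb; apply: le_trans (f_convex _ _ _ t01) _.
have /andP[t0 t1] := t01.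
rewrite [leRHS](_ : _ = t%:E * a%:E + (1 - t)%:E * b%:E)%E//.
apply: leeD; apply: lee_wpmul2l => //; rewrite lee_fin; lra.
Qed.

Lemma epiconeD x c u r v r' :
  epicone f x c u r -> epicone f x c v r' -> epicone f x c (u + v) (r + r').
Proof.
move=> [s s0 hs] [t t0 ht]; exists (s * t / (s + t)).
  by rewrite divr_gt0 ?mulr_gt0 ?addr_gt0.
have st0 : 0 < s + t by rewrite addr_gt0.
have h01 : 0 < t / (s + t) < 1.
  by rewrite divr_gt0//= ltr_pdivrMr// mul1r ltrDr.
have := econvex_epi _ _ _ _ _ h01 hs ht.
congr (f _ <= _%:E)%E; last by field; lra.
by apply/rowP => i; rewrite !mxE; field; lra.
Qed.

Lemma epiconeZ x c l u r :
  0 < l -> epicone f x c u r -> epicone f x c (l *: u) (l * r).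
Proof.
move=> l0 [t t0 ht]; exists (t / l); first by rewrite divr_gt0.
by rewrite scalerA mulrA divfK ?gt_eqF.
Qed.

Lemma epicone_ge x c C u r :
  minorized f x c C -> epicone f x c u r -> - (C * `|u|) <= r.
Proof.
move=> fC [t t0 /fC]; rewrite addrAC subrr add0r normrZ gtr0_norm// => h.
rewrite -(ler_pM2l t0); lra.
Qed.

(** The Hahn-Banach functional of the regularized directional derivative
[r + D * `|u - w|], minimized over [epicone f x c w r], touching at [u].  The
regularization makes that function finite even if [f] is infinite in some
directions; it is bounded below because [C <= D]. *)
Lemma subgradient_direction x c C D u : (forall y, (-oo < f y)%E) ->
  f x = c%:E -> minorized f x c C -> 0 <= C <= D ->
  exists2 s, subdiff f x s & forall eta, 0 < eta ->
    exists w r, epicone f x c w r /\ r + D * `|u - w| < dotv s u + eta.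
Proof.
move=> f_gt fx fC /andP[C0 CD].
pose S v r := exists w r', epicone f x c w r' /\ r' + D * `|v - w| <= r.
have D0 : 0 <= D by exact: le_trans CD.
have E00 : epicone f x c 0 0.
  by exists 1 => //; rewrite scaler0 addr0 mulr0 addr0 fx.
have Dge v w r' : epicone f x c w r' -> - (C * `|v|) <= r' + D * `|v - w|.
  move=> /(epicone_ge _ _ _ _ _ fC).
  have : C * `|w| <= C * (`|v| + `|v - w|).
    by rewrite ler_wpM2l// -{1}(subKr v w) ler_normB.
  have : C * `|v - w| <= D * `|v - w| by rewrite ler_wpM2r.
  lra.
have [] := lower_envelope_sublinear S.
- move=> v1 r1 v2 r2 [w1 [r1' [h1 le1]]] [w2 [r2' [h2 le2]]].
  exists (w1 + w2), (r1' + r2'); split; first exact: epiconeD.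
  have : D * `|v1 + v2 - (w1 + w2)| <= D * (`|v1 - w1| + `|v2 - w2|).
    by rewrite ler_wpM2l// opprD addrACA ler_normD.
  lra.
- move=> l v r l0 [w [r' [h le]]]; exists (l *: w), (l * r').
  split; first exact: epiconeZ.
  rewrite -scalerBr normrZ gtr0_norm// mulrCA -mulrDr ler_pM2l//.
- by move=> v; exists (D * `|v|), 0, 0; split; rewrite // subr0 add0r.
- move=> v; exists (- (C * `|v|)) => r [w [r' [h]]]; apply: le_trans.
  exact: Dge.
move=> p [sp pS pge]; have [s [s_le us]] := sublinear_support p u sp.
exists s; last first.
  move=> eta eta0; apply: contrapT => hn.
  suff : p u + eta <= p u by rewrite gerDl leNgt eta0.
  apply: pge => r [w [r' [h]]]; apply: le_trans; rewrite leNgt; apply/negP => lt.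
  by apply: hn; exists w, r'; split=> //; apply: lt_le_trans lt _; rewrite lerD2r.
split; first by rewrite fx.
move=> y; rewrite fx; case fy : (f y) => [a| |].
- rewrite lee_fin -lerBrDl; apply: le_trans (s_le _) _; apply: pS.
  exists (y - x), (a - c); split; last by rewrite subrr normr0 mulr0 addr0.
  by exists 1 => //; rewrite scale1r mul1r subrKC subrKC fy.
- by rewrite leey.
- by have := f_gt y; rewrite fy.
Qed.

(** Reflect [y] through [x] to a point at distance [d / 2], where [f] is at most
[M]: convexity on the segment between the two points bounds [f y] below. *)
Lemma minorized_of_bounded x c d M : 0 < d -> f x = c%:E ->
  (forall v, `|v| < d -> (f (x + v)%R <= M%:E)%E) ->
  minorized f x c ((M - c) / (d / 2)).
Proof.
move=> d0 fx fM y a fy; have e0 : 0 < d / 2 by lra.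
set e := d / 2 in e0 *.
have [yx|yx] := eqVneq y x.
  by rewrite yx subrr normr0 mulr0 subr0 -lee_fin -fx -yx.
have dist0 : 0 < `|y - x| by rewrite normr_gt0 subr_eq0.
set k := `|y - x| in dist0 *.
have t01 : 0 < e / (e + k) < 1.
  by rewrite divr_gt0 ?addr_gt0//= ltr_pdivrMr ?addr_gt0// mul1r ltrDl.
(* The reflection of y, at distance e = d / 2 from x on the other side. *)
have fz : (f (x + (- (e / k)) *: (y - x))%R <= M%:E)%E.
  by apply: fM; rewrite normrZ normrN gtr0_norm ?divr_gt0// divfK ?gt_eqF// /e; lra.
have := econvex_epi _ _ _ _ _ t01 fy fz.
have -> : (e / (e + k)) *: y + (1 - e / (e + k)) *: (x + - (e / k) *: (y - x)) = x.
  by apply/rowP => i; rewrite !mxE; field; rewrite !gt_eqF// addr_gt0.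
rewrite fx lee_fin => h.
have ek : 0 < e + k by rewrite addr_gt0.
have {}h : c * (e + k) <= e * a + k * M.
  move: h; rewrite -(ler_pM2r ek) => /le_trans; apply.
  by rewrite le_eqVlt; apply/orP; left; apply/eqP; field; rewrite gt_eqF.
rewrite -(ler_pM2l e0).
have -> : e * (c - (M - c) / e * k) = e * c - (M - c) * k by field; rewrite gt_eqF.
lra.
Qed.

End ConvexFunction.

(** A form of Jensen's inequality for sets.  With dyadic weights each step of the
induction is a single midpoint, and [0] takes the remaining weight; with equal
weights the step would depend on the number of terms. *)
Lemma dyadic_sum_closed {R : realType} {V : lmodType R} (S : V -> Prop) :
  S 0 -> (forall u v, S u -> S v -> S (2^-1 *: u + 2^-1 *: v)) ->
  forall k (F : 'I_k -> V), (forall i, S (F i)) ->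
    S (\sum_(i < k) (2 ^- i.+1) *: F i).
Proof.
move=> S0 S2; elim=> [F _|k IH F SF]; first by rewrite big_ord0.
rewrite big_ord_recl.
have -> : \sum_(i < k) 2 ^- (lift ord0 i).+1 *: F (lift ord0 i) =
    2^-1 *: \sum_(i < k) 2 ^- i.+1 *: F (lift ord0 i).
  rewrite scaler_sumr; apply: eq_bigr => i _.
  by rewrite scalerA -invfM -exprS.
rewrite /= expr1; apply: S2 => //.
by apply: (IH (F \o lift ord0)) => i /=.
Qed.

(** [f] is at most [M] at the centre and at the points [x + b e_i], [x - b e_i] of a
cross-polytope, hence on the small cube that consists of dyadic combinations of
points on its axes. *)
Lemma convex_locally_bounded {R : realType} {n : nat} (f : 'rV[R]_n -> \bar R)
    (x : 'rV[R]_n) (e : R) : econvex f -> (forall y, (-oo < f y)%E) -> 0 < e ->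
  (forall v, `|v| < e -> (f (x + v)%R < +oo)%E) ->
  exists M, exists2 d, 0 < d & forall v, `|v| < d -> (f (x + v)%R <= M%:E)%E.
Proof.
move=> f_convex f_gt e0 f_lt.
have f_fin v : `|v| < e -> f (x + v) = (fine (f (x + v)))%:E.
  by move=> ve; rewrite fineK// fin_numE gt_eqF ?f_gt//= lt_eqF// f_lt.
(* Half the radius: the vertices must lie strictly inside the ball. *)
pose b : R := e / 2; have b0 : 0 < b by rewrite /b; lra.
have be : b < e by rewrite /b; lra.
have delta_lt i a : `|a| < e -> `|a *: delta_mx ord0 i : 'rV[R]_n| < e.
  move=> ae; apply: le_lt_trans ae; rewrite normrZ ler_piMr//.
  have -> : `|delta_mx ord0 i : 'rV[R]_n| = mx_norm (delta_mx ord0 i : 'rV[R]_n).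
    by [].
  rewrite mx_normrE; apply: bigmax_le => // -[k l] _; rewrite mxE.
  by case: (_ && _); rewrite ?normr1 ?normr0.
pose F (ij : 'I_n * bool) :=
  fine (f (x + (if ij.2 then b else - b) *: delta_mx ord0 ij.1)).
pose M := \big[Num.max/fine (f x)]_ij F ij.
pose S v := (f (x + v)%R <= M%:E)%E.
have SM v : `|v| < e -> fine (f (x + v)) <= M -> S v.
  by move=> ve vM; rewrite /S f_fin// lee_fin.
have Sb i (a : bool) : S ((if a then b else - b) *: delta_mx ord0 i).
  apply: SM; last exact: (le_bigmax _ F (i, a)).
  by apply: delta_lt; case: a; rewrite ?normrN gtr0_norm.
have S0 : S 0.
  by apply: SM; rewrite ?normr0// addr0; exact: bigmax_ge_id.
have Sconv t u v : 0 < t < 1 -> S u -> S v -> S (t *: u + (1 - t) *: v).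
  move=> t01 Su Sv; have := econvex_epi f f_convex _ _ _ _ _ t01 Su Sv.
  rewrite -mulrDl subrKC mul1r /S; congr (f _ <= _)%E.
  by apply/rowP => i; rewrite !mxE; ring.
have Sdelta i a : `|a| < b -> S (a *: delta_mx ord0 i).
  rewrite ltr_norml => /andP[ab1 ab2].
  have t01 : 0 < (a / b + 1) / 2 < 1.
    have : -1 < a / b by rewrite ltr_pdivlMr// mulN1r.
    have : a / b < 1 by rewrite ltr_pdivrMr// mul1r.
    by move=> *; apply/andP; split; lra.
  have := Sconv _ _ _ t01 (Sb i true) (Sb i false); congr S.
  by apply/rowP => k; rewrite !mxE; field; rewrite gt_eqF.
exists M; exists (b / 2 ^+ n); first by rewrite divr_gt0// exprn_gt0.
move=> v vd.
have : S (\sum_(i < n) 2 ^- i.+1 *: ((2 ^+ i.+1 * v ord0 i) *: delta_mx ord0 i)).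
  apply: (dyadic_sum_closed S) => // [u w Su Sw|i].
    have -> : 2^-1 *: w = (1 - 2^-1) *: w by congr (_ *: _); lra.
    by apply: Sconv => //; apply/andP; split; lra.
  apply: Sdelta; rewrite normrM ger0_norm ?exprn_ge0//.
  apply: le_lt_trans (_ : 2 ^+ n * `|v| < b); last first.
    by rewrite mulrC -ltr_pdivlMr// exprn_gt0.
  apply: ler_pM => //; last exact: le_coord_norm.
  by rewrite ler_weXn2l// ler1n.
rewrite /S; congr (f (_ + _)%R <= _)%E; rewrite {2}(matrix_sum_delta v) big_ord1.
by apply: eq_bigr => i _; rewrite scalerA mulrA mulVf ?mul1r// expf_neq0.
Qed.

(** The point is that [x] may lie on the boundary of the domain of [f].
[subgradient_direction] gives directions [w] in the cone that are as close as
wished to [u' = u - eps *: (y0 - x)]; adding a multiple [eps] of a direction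
that points into the ball around [y0] reaches [u] exactly, at a cost of order
[eps]. *)
Lemma directional_bound {R : realType} {n : nat} (f : 'rV[R]_n -> \bar R)
    (x y0 : 'rV[R]_n) (c C B d M : R) :
  econvex f -> (forall y, (-oo < f y)%E) ->
  f x = c%:E -> minorized f x c C -> 0 <= C ->
  0 < d -> (forall v, `|v| < d -> (f (y0 + v)%R <= M%:E)%E) ->
  0 <= B -> (forall s, subdiff f x s -> enorm s <= B) ->
  forall u eta, 0 < eta -> epicone f x c u (B * enorm u + eta).
Proof.
move=> f_convex f_gt fx fC C0 d0 fM B0 fB u eta eta0.
(* The choice of eps keeps the total cost eps * A of the shift at eta / 2. *)
pose w0 := y0 - x; pose A := B * enorm w0 + `|M - c| + 1.
have A0 : 0 < A by rewrite /A ltr_wpDl// addr_ge0// mulr_ge0// enorm_ge0.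
pose eps := eta / 2 / A; have eps0 : 0 < eps by rewrite !divr_gt0.
pose u' := u - eps *: w0.
pose K := B * enorm u' + eta / 2 + C * `|u'|.
have K0 : 0 <= K by rewrite !addr_ge0 ?mulr_ge0 ?enorm_ge0// ltW// divr_gt0.
have K1 : 0 < K + 1 by lra.
have ed : 0 < eps * d by exact: mulr_gt0.
(* Large enough for the gap between u' and w to be below eps * d. *)
pose D := C + (K + 1) / (eps * d).
have CD : 0 <= C <= D by rewrite C0/= /D lerDl ltW// divr_gt0.
have [s s_sub s_dir] := subgradient_direction f f_convex x c C D u' f_gt fx fC CD.
have eta2 : 0 < eta / 2 by rewrite divr_gt0.
have [w [r [wr]]] := s_dir _ eta2.
have su : dotv s u' <= B * enorm u'.
  apply: le_trans (dotv_le _ _) _; apply: ler_wpM2r; first exact: enorm_ge0.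
  exact: fB.
move=> lt1.
have rge : - (C * `|u'|) - C * `|u' - w| <= r.
  apply: le_trans (epicone_ge f _ _ _ _ _ fC wr).
  rewrite -opprD lerN2 -mulrDr ler_wpM2l// -{1}(subKr u' w) ler_normB//.
have lt2 : (K + 1) / (eps * d) * `|u' - w| < K.
  by move: lt1; rewrite /D /K; lra.
have near : `|eps^-1 *: (u' - w)| < d.
  rewrite normrZ gtr0_norm ?invr_gt0// ltr_pdivrMl//.
  rewrite -(@ltr_pM2l _ ((K + 1) / (eps * d))); last exact: divr_gt0.
  apply: lt_le_trans lt2 _; rewrite divfK ?gt_eqF//; lra.
have E1 : epicone f x c (w0 + eps^-1 *: (u' - w)) (M - c).
  exists 1 => //; rewrite scale1r mul1r subrKC /w0 addrA subrKC; exact: fM.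
have := epiconeD f f_convex x c _ _ _ _ wr (epiconeZ f x c _ _ _ eps0 E1).
have -> : w + eps *: (w0 + eps^-1 *: (u' - w)) = u.
  by apply/rowP => i; rewrite !mxE; field; rewrite gt_eqF.
move=> [t t0 ht]; exists t => //; apply: le_trans ht _.
rewrite lee_fin lerD2l ler_pM2l//.
have eu : enorm u' <= enorm u + eps * enorm w0.
  rewrite /u' -scaleN1r; apply: le_trans (enormD _ _) _.
  by rewrite !enormZ normrN1 mul1r gtr0_norm.
have {}eu : B * enorm u' <= B * enorm u + B * (eps * enorm w0).
  by rewrite -mulrDr ler_wpM2l.
have D0 : 0 <= D * `|u' - w| by rewrite mulr_ge0//; case/andP: CD => ?; exact: le_trans.
have epsA : eps * A = eta / 2 by rewrite /eps divfK// gt_eqF.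
have Mc : eps * (M - c) <= eps * `|M - c| by rewrite ler_pM2l// ler_norm.
move: epsA; rewrite /A; lra.
Qed.

(** * Bounded subgradients on a convex set *)

Lemma nbhs_translate {R : realType} {n : nat} (x : 'rV[R]_n) (A : set 'rV[R]_n) :
  nbhs x A <-> exists2 e : R, 0 < e & forall v, `|v| < e -> A (x + v).
Proof.
split=> [/nbhs_ballP[e /= e0 eA]|[e e0 eA]].
  exists e => // v ve; apply: eA; rewrite mx_norm_ball /ball_/=.
  by rewrite opprD addNKr normrN.
apply/nbhs_ballP; exists e => //= y; rewrite mx_norm_ball /ball_/= => ye.
by rewrite -(subrKC x y); apply: eA; rewrite distrC.
Qed.

Lemma convex_set_segment {R : realType} {n : nat} (Y : set 'rV[R]_n) t y z :
  convex_set Y -> 0 <= t <= 1 -> Y y -> Y z -> Y (t *: y + (1 - t) *: z).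
Proof.
move=> Y_convex /andP[t0 t1] Yy Yz.
have := Y_convex y z (Itv01 t0 t1); rewrite !inE => h; exact: h.
Qed.

(** The interior case: everything that [directional_bound] asks of the point and
of the ball, with the ball centred at [x] itself. *)
Lemma minorized_of_finite_nbhs {R : realType} {n : nat} (f : 'rV[R]_n -> \bar R) x :
  econvex f -> (forall y, (-oo < f y)%E) -> nbhs x (edom f) ->
  exists c C M d, [/\ f x = c%:E, 0 <= C, minorized f x c C, 0 < d &
    forall v, `|v| < d -> (f (x + v)%R <= M%:E)%E].
Proof.
move=> f_convex f_gt /nbhs_translate[e e0 f_lt].
have [M [d d0 fM]] := convex_locally_bounded f x e f_convex f_gt e0 f_lt.
have fx : f x = (fine (f x))%:E.
  rewrite fineK// fin_numE gt_eqF ?f_gt//= lt_eqF//.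
  by have := f_lt 0; rewrite normr0 addr0; apply.
exists (fine (f x)), ((M - fine (f x)) / (d / 2)), M, d; split=> //.
  rewrite divr_ge0 ?subr_ge0//; last by rewrite ltW// divr_gt0.
  by rewrite -lee_fin -fx -[x]addr0; apply: fM; rewrite normr0.
exact: minorized_of_bounded.
Qed.

Lemma subdiff_minorized {R : realType} {n : nat} (f : 'rV[R]_n -> \bar R)
    x c s B :
  f x = c%:E -> subdiff f x s -> enorm s <= B -> minorized f x c (n%:R * B).
Proof.
move=> fx [_ hs] sB y a fy; have := le_trans (hs y) fy.
rewrite fx lee_fin; apply: le_trans; rewrite lerD2l.
apply: le_trans (dotv_ge _ _); rewrite lerN2.
by apply: ler_wpM2r => //; exact: ler_wpM2l.
Qed.

(** Difference quotients of a convex function are monotone along a ray. *)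
Lemma convex_ray_le {R : realType} {n : nat} (f : 'rV[R]_n -> \bar R)
    x c w r t t' : econvex f -> f x = c%:E -> 0 < t' <= t ->
  (f (x + t *: w)%R <= (c + t * r)%:E)%E ->
  (f (x + t' *: w)%R <= (c + t' * r)%:E)%E.
Proof.
move=> f_convex fx /andP[t'0]; rewrite le_eqVlt => /predU1P[->//|t't] ft.
have t0 : 0 < t by exact: lt_trans t't.
have k01 : 0 < t' / t < 1 by rewrite divr_gt0//= ltr_pdivrMr// mul1r.
have fxc : (f x <= c%:E)%E by rewrite fx.
have := econvex_epi f f_convex _ _ _ _ _ k01 ft fxc.
congr (f _ <= _%:E)%E; last by field; rewrite gt_eqF.
by apply/rowP => i; rewrite !mxE; field; rewrite gt_eqF.
Qed.

(** A uniform bound on the subgradients inside [Y] survives the passage to the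
boundary: the cones below [f] at points that approach [x] along a segment have the
same slope, and lower semicontinuity bounds [f x] by the limit of their apices. *)
Lemma minorized_of_subgradient_bound {R : realType} {n : nat} (f : 'rV[R]_n -> \bar R)
    (Y : set 'rV[R]_n) (x y0 : 'rV[R]_n) (B : R) :
  econvex f -> (forall y, (-oo < f y)%E) -> lower_semicontinuous f ->
  convex_set Y -> Y x -> Y° y0 -> Y° `<=` edom f -> 0 <= B ->
  (forall y s, Y y -> subdiff f y s -> enorm s <= B) ->
  exists2 c, f x = c%:E & minorized f x c (n%:R * B).
Proof.
move=> f_convex f_gt f_lsc Y_convex Yx Yy0 Ydom B0 fB.
have /nbhs_translate[e e0 Ye] := Yy0.
pose xt t := x + t *: (y0 - x).
have Yxt t : 0 < t <= 1 -> Y° (xt t).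
  move=> /andP[t0 t1]; apply/nbhs_translate; exists (t * e); first exact: mulr_gt0.
  move=> v ve; have -> : xt t + v = t *: (y0 + t^-1 *: v) + (1 - t) *: x.
    by apply/rowP => i; rewrite !mxE; field; rewrite gt_eqF.
  apply: convex_set_segment => //; first by rewrite ltW.
  by apply: Ye; rewrite normrZ gtr0_norm ?invr_gt0// ltr_pdivrMl.
set L : R := n%:R * B; have L0 : 0 <= L by rewrite mulr_ge0.
have at_xt t : 0 < t <= 1 -> exists2 c, f (xt t) = c%:E & minorized f (xt t) c L.
  move=> t01; have dom_t : nbhs (xt t) (edom f).
    by apply: filterS Ydom _; apply: nbhs_interior; exact: Yxt.
  have [c [C [M [d [fc C0 fC _ _]]]]] := minorized_of_finite_nbhs f _ f_convex f_gt dom_t.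
  have CC : 0 <= C <= C by rewrite C0 lexx.
  have [s ss _] := subgradient_direction f f_convex _ c C C 0 f_gt fc fC CC.
  exists c => //; apply: (subdiff_minorized f _ _ _ _ fc ss).
  by apply: fB ss; apply: nbhs_singleton; exact: Yxt.
have cone_at_x y a eta : (f y <= a%:E)%E -> 0 < eta ->
    (f x <= (a + L * `|y - x| + eta)%:E)%E.
  move=> fy eta0; rewrite leNgt; apply/negP => /f_lsc[V /nbhs_translate[r r0 Vr] fV].
  pose N := `|y0 - x|; have N0 : 0 <= N by exact: normr_ge0.
  (* Close enough to x for lower semicontinuity to apply at xt t, and for the slope
     of the cone to cost at most eta. *)
  pose t := Num.min 1 (Num.min (r / (N + 1)) (eta / (L * N + 1))).
  have LN0 : 0 < L * N + 1 by rewrite ltr_wpDl// mulr_ge0.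
  have t0 : 0 < t by rewrite !lt_min ltr01 !divr_gt0// ltr_wpDl.
  have t1 : t <= 1 by rewrite ge_min lexx.
  have tr : t * N < r.
    have : t <= r / (N + 1) by rewrite !ge_min lexx orbT.
    rewrite ler_pdivlMr ?ltr_wpDl//; lra.
  have te : L * (t * N) <= eta.
    have : t <= eta / (L * N + 1) by rewrite !ge_min lexx !orbT.
    rewrite ler_pdivlMr//; lra.
  have t01 : 0 < t <= 1 by rewrite t0.
  have [c fc fcL] := at_xt t t01.
  have := fV (xt t); rewrite fc lte_fin => /(_ _) h.
  have : a + L * `|y - x| + eta < c.
    by apply: h; apply: Vr; rewrite normrZ gtr0_norm.
  have := fcL _ _ fy.
  have : L * `|y - xt t| <= L * (`|y - x| + t * N).
    rewrite ler_wpM2l// /xt opprD addrA; apply: le_trans (ler_normB _ _) _.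
    by rewrite normrZ gtr0_norm.
  rewrite mulrDr; lra.
have f_y0 : f y0 = (fine (f y0))%:E.
  by rewrite fineK// fin_numE gt_eqF ?f_gt//= lt_eqF// Ydom.
have fx : f x = (fine (f x))%:E.
  rewrite fineK// fin_numE gt_eqF ?f_gt//= lt_eqF//.
  apply: le_lt_trans (cone_at_x y0 (fine (f y0)) 1 _ ltr01) (ltey _).
  by rewrite -f_y0.
exists (fine (f x)) => // y a fy; apply/ler_addgt0Pr => eta eta0.
have := cone_at_x y a eta fy eta0; rewrite fx lee_fin; lra.
Qed.

Theorem lemma3p3 (R : realType) (n m : nat) (m_gt0 : (0 < m)%N)
  (Y : set 'rV[R]_n)
  (Y_neq0 : Y !=set0) (Y_closed : closed Y) (Y_convex : convex_set Y)
  (h : 'I_m -> 'rV[R]_n -> \bar R)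
  (h_proper : forall j, proper_fun (h j))
  (h_lsc : forall j, lower_semicontinuous (h j))
  (h_convex : forall j, econvex (h j))
  (h_dom : forall j, Y° `<=` edom (h j))
  (* Only relevant if Y has empty interior: h_dom is then void, and the bound
     below does not follow from the other hypotheses. *)
  (h_dom_flat : Y° = set0 -> forall j, Y `<=` (edom (h j))°)
  (d : measure_display) (Omega : measurableType d)
  (Omega_finite : finite_set [set: Omega])
  (P : probability Omega R)
  (xi : 'I_m -> {RV P >-> R})
  (B : 'I_m -> R) (B_gt0 : forall j, 0 < B j)
  (h_bounded : forall j x g, Y x -> subdiff (h j) x g -> enorm g <= B j)
  (xi_ge0 : forall j w, 0 <= xi j w)
  (xi_mean : forall j, (0 < 'E_P[xi j])%E)
  (xibar : R) (xi_le : forall j w, xi j w <= xibar) :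
  forall (x : 'rV[R]_n) (w : Omega) (g : 'rV[R]_n),
    Y x -> subdiff (max_scaled (fun j => xi j w) h) x g ->
    enorm g <= xibar * \big[Num.max/0]_(j < m) B j.
Proof.
move=> x w g Yx [F_fin Fg].
set Bmax := \big[Num.max/0]_(j < m) B j.
have BB j : B j <= Bmax by exact: (le_bigmax 0 B j).
have Bmax0 : 0 <= Bmax by exact: (le_trans (ltW (B_gt0 (Ordinal m_gt0)))).
have xibar0 : 0 <= xibar by exact: le_trans (xi_le (Ordinal m_gt0) w).
have dir j : exists2 c, h j x = c%:E &
    forall eta, 0 < eta -> epicone (h j) x c g (Bmax * enorm g + eta).
  have h_gt := (h_proper j).2.
  have [c [C [y0 [d' [M [hx C0 hC d0 hM]]]]]] : exists c C y0 d M,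
      [/\ h j x = c%:E, 0 <= C, minorized (h j) x c C, 0 < d &
          forall v, `|v| < d -> (h j (y0 + v)%R <= M%:E)%E].
    (* If Y has an interior point, the ball is centred there: at this stage h j is
       not known to be finite around x. *)
    have [Y0|/set0P[y0 Yy0]] := eqVneq Y° set0.
      have x_dom : nbhs x (edom (h j)) by exact: h_dom_flat Y0 j x Yx.
      have [c [C [M [d0 [? ? ? ? ?]]]]] :=
        minorized_of_finite_nbhs (h j) x (h_convex j) h_gt x_dom.
      by exists c, C, x, d0, M.
    have y0_dom : nbhs y0 (edom (h j)).
      by apply: filterS (h_dom j) _; exact: nbhs_interior.
    have [_ [_ [M [d0 [_ _ _ d00 hM]]]]] :=
      minorized_of_finite_nbhs (h j) y0 (h_convex j) h_gt y0_dom.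
    have [c hx hc] := minorized_of_subgradient_bound (h j) Y x y0 (B j) (h_convex j) h_gt
      (h_lsc j) Y_convex Yx Yy0 (h_dom j) (ltW (B_gt0 j)) (h_bounded j).
    by exists c, (n%:R * B j), y0, d0, M; split; rewrite // mulr_ge0// ltW.
  exists c => // eta eta0.
  apply: (directional_bound (h j) x y0 c C Bmax d' M) => // s /(h_bounded j _ _ Yx).
  by move=> /le_trans; apply.
have key eta : 0 < eta -> enorm g ^+ 2 <= xibar * (Bmax * enorm g + eta).
  move=> eta0; set K := Bmax * enorm g + eta.
  have K0 : 0 <= K by rewrite addr_ge0 ?mulr_ge0 ?enorm_ge0// ltW.
  have /choice[T hT] : forall j, exists t, 0 < t /\
      forall t', 0 < t' <= t -> exists2 c, h j x = c%:E &
        (h j (x + t' *: g)%R <= (c + t' * K)%:E)%E.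
    move=> j; have [c hx /(_ eta eta0)[t t0 ht]] := dir j.
    exists t; split=> // t' t't; exists c => //.
    exact: convex_ray_le ht.
  (* One step length that suits all the h j; the default 1 only bounds it. *)
  pose t := \big[Num.min/1]_(j < m) T j.
  have t0 : 0 < t by apply: lt_bigmin => // j _; exact: (hT j).1.
  have tT j : t <= T j by exact: bigmin_le.
  pose F := max_scaled (fun j => xi j w) h.
  have Fx : F x = (fine (F x))%:E by rewrite fineK.
  have Fle : (F (x + t *: g)%R <= (fine (F x) + t * (xibar * K))%:E)%E.
    (* Every index is compared with F x, whether it is active at x or not. *)
    rewrite EFinD -Fx; apply: bigmax_le => [|j _]; first exact: leNye.
    have tTj : 0 < t <= T j by rewrite t0 tT.
    have [c hx ht] := (hT j).2 t tTj.
    apply: le_trans (_ : ((xi j w)%:E * (c + t * K)%:E <= _)%E).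
      by apply: lee_wpmul2l; rewrite ?lee_fin.
    rewrite -EFinM mulrDr EFinD EFinM -hx; apply: leeD.
      exact: (le_bigmax -oo%E (fun j => (xi j w)%:E * h j x)%E).
    rewrite lee_fin mulrCA ler_pM2l// ler_wpM2r//.
  have := le_trans (Fg (x + t *: g)) Fle.
  rewrite -/F Fx lee_fin lerD2l addrAC subrr add0r dotvZr ler_pM2l//.
  by rewrite sqr_enorm.
have key0 : enorm g ^+ 2 <= xibar * Bmax * enorm g.
  apply/ler_addgt0Pr => e e0; have x1 : 0 < xibar + 1 by lra.
  apply: le_trans (key (e / (xibar + 1)) _) _; first exact: divr_gt0.
  rewrite mulrDr -mulrA lerD2l mulrCA ger_pMr// ler_pdivrMr//; lra.
have := enorm_ge0 g; rewrite le_eqVlt => /predU1P[<-|g0]; first exact: mulr_ge0.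
by rewrite -(ler_pM2r g0) -expr2.
Qed.
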